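(* Assume that there exist functions $m_1,m_2:S\to[2,+\infty)$ and $\varphi_1,\varphi_2,\psi_1,\psi_2:S\to(0,+\infty)$ such that $$\psi_1(x)+\varphi_1(x)t^{m_1(x)-1}\le f(x,t)\le \varphi_2(x)t^{m_2(x)-1}+\psi_2(x)\quad\text{for all }x\in S,\ t\ge 0,$$ and let $m_1^->\overline p^+$. Let $\gamma_0:=2^{\frac12}|\partial S|^{\frac12}|\overline S|$, choose $\gamma>\gamma_0$, and put $$\lambda_3:=\frac{q^-2^{-\frac{p^-}{2}}|\partial S|^{\frac{p^-}{2}}|\overline S|^{1-p^-}\gamma^{p^-}-q^-|S|}{\left(\varphi_2^+\gamma^{m_2^+}+\varphi_2^++\psi_2^+|\overline S|^{\frac12}\gamma\right)|S|}.$$ Then for every $\lambda\in(0,\lambda_3)$ the problem $$\begin{cases}-\Delta_{p(x),\omega}u(x)+q(x)|u(x)|^{p(x)-2}u(x)=\lambda f(x,u(x)), & x\in S,\\ u(x)=0, & x\in\partial S,\end{cases}$$ has at least two distinct positive solutions, with at least one positive solution outside the unit ball of $A$.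
   Context: Let $\overline S=(S\cup\partial S,V)$ be a simple, connected, undirected, weighted graph whose vertex set is the union of two finite, disjoint, nonempty sets $S$ (interior) and $\partial S$ (boundary), and whose edge set is $V$, a set of unordered pairs of distinct vertices. The symbol $\overline S$ also denotes the vertex set $S\cup\partial S$; $|\cdot|$ of a set is its cardinality. The weight is a function $\omega:\overline S\times\overline S\to[0,+\infty)$ with $\omega(x,y)=\omega(y,x)$ if $\{x,y\}\in V$, and $\omega(x,y)=0$ if and only if $\{x,y\}\notin V$. The functions $q:S\to(0,+\infty)$ and $p:\overline S\to[2,+\infty)$ are given, and $f:S\times\mathbb R\to\mathbb R$ is such that $f(x,\cdot)$ is continuous for each $x\in S$. The discrete $p(\cdot)$-Laplacian of $u:\overline S\to\mathbb R$ is $$\Delta_{p(x),\omega}u(x)=\sum_{y\in\overline S}|u(y)-u(x)|^{p(x)-2}(u(y)-u(x))\,\omega(x,y),\quad x\in\overline S.$$ A positive solution is a function $u:\overline S\to\mathbb R$ satisfying the equation on $S$, the boundary condition $u=0$ on $\partial S$, and $u(x)>0$ for all $x\in S$. The space $A=\{u:\overline S\to\mathbb R: u(x)=0\text{ for all }x\in\partial S\}$ carries the norm $\|u\|=\left(\sum_{x\in\overline S}|u(x)|^2\right)^{1/2}$; the unit ball is taken with respect to this norm. Notation: $p^-=\min_{S}p$, $\overline p^+=\max_{\overline S}p$, $q^-=\min_S q$, $m_1^-=\min_S m_1$, $m_2^+=\max_S m_2$, $\varphi_2^+=\max_S\varphi_2$, $\psi_2^+=\max_S\psi_2$. *)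

(* Defs.v *)
From HB Require Import structures.
From mathcomp Require Import all_boot all_order all_algebra.
From mathcomp Require Import boolp reals topology normedtype exp.

Set Implicit Arguments.
Unset Strict Implicit.
Unset Printing Implicit Defensive.
Import Order.TTheory GRing.Theory Num.Theory.
Import numFieldNormedType.Exports.
Local Open Scope ring_scope.

(* Simple connected undirected weighted graph; an edge {x, y} is represented by
   [edge x y], and the irreflexivity of [edge] makes [weight x x] vanish. *)
Record wgraph (R : realType) (T : finType) := WGraph {
  edge : rel T;
  edge_sym : symmetric edge;
  edge_irr : irreflexive edge;
  edge_connected : forall x y : T, connect edge x y;
  weight : T -> T -> R;
  weight_ge0 : forall x y, 0 <= weight x y;
  weight_sym : forall x y, edge x y -> weight x y = weight y x;
  weight_eq0 : forall x y, weight x y = 0 <-> ~~ edge x y }.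

Section Extrema.
Variables (R : realType) (T : finType).
Implicit Types (A : {set T}) (g : T -> R).

(* The value 0 on the empty set is a dummy. *)
Definition setmin A g : R :=
  if [pick x in A] is Some x0 then g [arg min_(x < x0 in A) g x]%O else 0.

Definition setmax A g : R :=
  if [pick x in A] is Some x0 then g [arg max_(x > x0 in A) g x]%O else 0.

Lemma setminP A g : (0 < #|A|)%N ->
  (exists2 x, x \in A & setmin A g = g x) /\
  (forall x, x \in A -> setmin A g <= g x).
Proof.
rewrite /setmin; case: pickP => [x0 Ax0 _|A0]; last by rewrite (eq_card0 A0).
by case: arg_minP => // i Ai le_i; split=> //; exists i.
Qed.

Lemma setmaxP A g : (0 < #|A|)%N ->
  (exists2 x, x \in A & setmax A g = g x) /\
  (forall x, x \in A -> g x <= setmax A g).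
Proof.
rewrite /setmax; case: pickP => [x0 Ax0 _|A0]; last by rewrite (eq_card0 A0).
by case: arg_maxP => // i Ai le_i; split=> //; exists i.
Qed.

End Extrema.

Section Problem.
Variables (R : realType) (T : finType).

(* Functions given on S only are total functions on T whose values outside S
   are never used.  With p x = 2, [0 `^ 0 = 1] is harmless since it is always
   multiplied by a zero factor. *)

Definition plaplacian (G : wgraph R T) (p u : T -> R) (x : T) : R :=
  \sum_(y : T) `|u y - u x| `^ (p x - 2) * (u y - u x) * weight G x y.

Definition positive_solution (G : wgraph R T) (S dS : {set T}) (p q : T -> R)
    (f : T -> R -> R) (lambda : R) (u : T -> R) : Prop :=
  [/\ forall x, x \in S ->
        - plaplacian G p u x + q x * `|u x| `^ (p x - 2) * u x
          = lambda * f x (u x),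
      forall x, x \in dS -> u x = 0 &
      forall x, x \in S -> 0 < u x].

Definition l2norm (u : T -> R) : R := Num.sqrt (\sum_(x : T) `|u x| ^+ 2).

Definition gamma0 (dS : {set T}) : R :=
  2 `^ (1 / 2) * #|dS|%:R `^ (1 / 2) * #|T|%:R.

Definition lambda3 (S dS : {set T}) (p q m2 phi2 psi2 : T -> R) (gamma : R) : R :=
  let pm := setmin S p in
  let qm := setmin S q in
  let m2p := setmax S m2 in
  let phi2p := setmax S phi2 in
  let psi2p := setmax S psi2 in
  (qm * 2 `^ (- (pm / 2)) * #|dS|%:R `^ (pm / 2) * #|T|%:R `^ (1 - pm)
     * gamma `^ pm - qm * #|S|%:R)
  / ((phi2p * gamma `^ m2p + phi2p + psi2p * #|T|%:R `^ (1 / 2) * gamma)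
     * #|S|%:R).

End Problem.

(* Main.v *)
Require Import Defs.
From mathcomp Require Import all_boot all_order all_algebra.
From mathcomp Require Import zify.

(* Let F x u be the defect of the equation at x (right-hand side minus left-hand
   side).  For u >= 0 vanishing on the boundary, F x u > 0 where u x = 0, while at
   a maximum point x of u one has F x u < 0 if u x = gamma (because lambda <
   lambda3) and F x u > 0 if u x = M is large (because m1 > p).  As p depends on
   x there is no potential, but these signs suffice topologically: F points into
   the box [0, gamma]^S, hence has a zero there, and on the shell
   gamma <= max u <= M, which is a simplex times an interval, it points inwards at
   the sides and outwards at both ends, hence has a zero there too; its norm
   exceeds gamma > 1.  Both zeros come from a covering lemma: if closed sets P i
   cover the simplex, some point z lies in P i for every i with z i > 0.  This
   follows from Scarf's combinatorial lemma applied to finer and finer grids. *)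

Set Implicit Arguments.
Unset Strict Implicit.
Unset Printing Implicit Defensive.

(** * Scarf's lemma *)

Section IndexedOrders.
Variables (I X : finType) (r : I -> X -> nat).
Hypothesis r_inj : forall i, injective (r i).
Implicit Types (D A : {set X}) (i a b : I) (x y z : X).

Definition below i y D := [exists x in D, r i x < r i y].

(** A dominant set with [#|I|] elements is a primitive set in Scarf's sense: no [y] lies strictly
    above the minimum of [D] in every order at once. *)
Definition dominant D := [forall y, exists i, ~~ below i y D].

Lemma belowP i y D :
  reflect (exists2 x, x \in D & r i x < r i y) (below i y D).
Proof. exact: exists_inP. Qed.

Lemma nbelowP i y D :
  reflect {in D, forall x, r i y <= r i x} (~~ below i y D).
Proof.
rewrite negb_exists_in; apply: (iffP forall_inP) => H x /H; by rewrite -leqNgt.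
Qed.

Lemma dominantP D : reflect (forall y, exists i, ~~ below i y D) (dominant D).
Proof. by apply: (iffP forallP) => H y; apply/existsP. Qed.

Lemma dominantF D y : dominant D -> ~ (forall i, below i y D).
Proof. by move=> /dominantP/(_ y)[i /negP ni] H; apply: ni. Qed.

Lemma belowS i y D A : D \subset A -> below i y D -> below i y A.
Proof. by move=> /subsetP DA /belowP[x /DA xA lt]; apply/belowP; exists x. Qed.

Lemma dominantS D A : D \subset A -> dominant A -> dominant D.
Proof.
move=> DA /dominantP H; apply/dominantP => y; have [i] := H y.
by move=> nb; exists i; apply: contra nb; apply: belowS.
Qed.

Definition ismin i x D := (x \in D) && ~~ below i x D.

Lemma ismin_inj i x y D : ismin i x D -> ismin i y D -> x = y.
Proof.
move=> /andP[xD /nbelowP hx] /andP[yD /nbelowP hy]; apply: (@r_inj i).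
by apply/eqP; rewrite eqn_leq hx ?hy.
Qed.

Lemma ismin_ex i D x : x \in D -> exists y, ismin i y D.
Proof.
move=> xD; case: (arg_minnP (r i) xD) => y yD hy.
by exists y; apply/andP; split=> //; apply/nbelowP.
Qed.

Lemma dominant_ismin D x : dominant D -> x \in D -> exists i, ismin i x D.
Proof. by move=> /dominantP/(_ x)[i nb] xD; exists i; apply/andP. Qed.

(* A door [D] (a dominant set one element short) extends to a room [y |: D] only
   if [y] becomes the new minimum for some order [a]; the two conditions on [y]
   are [candidate a y D] and maximality for [a], and [a] must be [doubled], i.e.
   dispensable among the orders whose minima exhaust [D]. *)
Definition candidate a y D := [forall i, (i != a) ==> below i y D].

Definition doubled a D := [forall x in D, exists i, (i != a) && ismin i x D].

Definition entering a y D :=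
  candidate a y D && [forall z, candidate a z D ==> (r a z <= r a y)].

Lemma entering_inj a y z D : entering a y D -> entering a z D -> y = z.
Proof.
move=> /andP[cy /forallP hy] /andP[cz /forallP hz]; apply: (@r_inj a).
apply/eqP; rewrite eqn_leq.
by rewrite (implyP (hz y) cy) (implyP (hy z) cz).
Qed.

Lemma entering_ex a y D : candidate a y D -> exists z, entering a z D.
Proof.
move=> cy; case: (@arg_maxnP _ y (fun z => candidate a z D) (r a) cy) => z cz hz.
by exists z; apply/andP; split=> //; apply/forallP => t; apply/implyP => /hz.
Qed.

(** An element [z] violating the dominance of [y |: D] would itself be a candidate, because [y] is
    above the minimum of [D] in every order other than [a]. By maximality [z] does not exceed [y] in
    order [a], so it would already violate the dominance of [D]. That [a] is doubled keeps [y] out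
    of [D]. *)
Lemma entering_room a y D : dominant D -> doubled a D -> entering a y D ->
  y \notin D /\ dominant (y |: D).
Proof.
move=> dD /forall_inP dbl /andP[/forallP cy /forallP ymax].
have yD : y \notin D.
  apply/negP => /dbl/existsP[i /andP[ia /andP[_]]].
  by rewrite (implyP (cy i) ia).
split=> //; apply/forallP => z; rewrite -[[exists i, _]]negbK; apply/negP => /existsPn H.
have {}H i : below i z (y |: D) by have := H i; rewrite negbK.
have cz : candidate a z D.
  apply/forallP => i; apply/implyP => ia.
  have /belowP[x] := H i; rewrite !inE => /orP[/eqP->|xD] lt; last first.
    by apply/belowP; exists x.
  have /belowP[t tD tlt] := implyP (cy i) ia.
  by apply/belowP; exists t => //; apply: ltn_trans lt.
apply: (@dominantF D z dD) => i.
have [->|ia] := eqVneq i a; last exact: (implyP (forallP cz i) ia).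
have /belowP[x] := H a; rewrite !inE => /orP[/eqP->|xD] lt; last first.
  by apply/belowP; exists x.
by have := implyP (ymax z) cz; rewrite leqNgt lt.
Qed.

Lemma room_inj A (m : I -> X) : dominant A -> #|A| = #|I| ->
  (forall i, ismin i (m i) A) -> injective m.
Proof.
move=> dA cA hm; have imE : m @: setT = A.
  apply/setP => x; apply/imsetP/idP => [[i _ ->]|xA].
    by case/andP: (hm i).
  have [i ix] := dominant_ismin dA xA; exists i; rewrite ?inE //.
  exact: ismin_inj ix (hm i).
have /imset_injP inj : #|m @: setT| == #|[set: I]| by rewrite imE cA cardsT.
by move=> i j; apply: inj; rewrite inE.
Qed.

(** Converse of [entering_room]. In a room, taking minima is a bijection from the orders to the
    elements; [a] is the order with minimum [y], and the other orders keep their minima in [D],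
    which they exhaust. *)
Lemma room_entering y D : #|D|.+1 = #|I| -> y \notin D -> dominant (y |: D) ->
  exists a, doubled a D /\ entering a y D.
Proof.
move=> cD yD dA; set A := y |: D in dA *.
have yA : y \in A by rewrite !inE eqxx.
have cA : #|A| = #|I| by rewrite cardsU1 yD add1n.
have [m hm] := fin_all_exists (fun i => ismin_ex i yA).
have minj := room_inj dA cA hm.
have [a /= ia] := dominant_ismin dA yA; exists a.
have ma : m a = y by apply: ismin_inj (hm a) ia.
have mD i : i != a -> m i \in D.
  move=> ne; have /andP[] := hm i; rewrite !inE => /orP[/eqP e|//].
  by move: ne; rewrite (minj i a) ?eqxx // ma.
have minD i : i != a -> ismin i (m i) D.
  move=> ne; apply/andP; split; first exact: mD.
  have /andP[_] := hm i; apply: contra; apply: belowS; exact: subsetUr.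
split.
  apply/forall_inP => x xD; apply/existsP.
  have xA : x \in A by rewrite !inE xD orbT.
  have [i ix] := dominant_ismin dA xA; exists i.
  have e : m i = x by apply: ismin_inj (hm i) ix.
  have ne : i != a by apply: contraNneq yD => ea; rewrite -ma -ea e.
  by rewrite ne -e minD.
apply/andP; split.
  apply/forallP => i; apply/implyP => ne; apply/belowP.
  exists (m i); first exact: mD.
  have /andP[mA /nbelowP /(_ y yA)] := hm i; rewrite leq_eqVlt => /orP[|//].
  by move=> /eqP/r_inj e; move: (mD i ne); rewrite e (negPf yD).
apply/forallP => z; apply/implyP => /forallP cz.
have /dominantP/(_ z)[i nb] := dA.
have [e|ne] := eqVneq i a; first by move/nbelowP: nb => /(_ y yA); rewrite e.
case/negP: nb; apply: belowS (implyP (cz i) ne); exact: subsetUr.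
Qed.

(** The map from orders to minima sends [I] onto [D] with one index too many, hence has a single
    collision; the two colliding orders are the doubled ones. *)
Lemma door_doubled D t : dominant D -> #|D|.+1 = #|I| -> t \in D ->
  exists a b, [/\ a != b, doubled a D, doubled b D,
    (exists2 x, ismin a x D & ismin b x D) &
    forall c, doubled c D -> c = a \/ c = b].
Proof.
move=> dD cD tD.
have [m hm] := fin_all_exists (fun i => ismin_ex i tD).
have imE (J : {set I}) : (forall x, x \in D -> exists2 i, i \in J & ismin i x D) ->
    m @: J = D.
  move=> hJ; apply/setP => x; apply/imsetP/idP => [[i _ ->]|xD].
    by case/andP: (hm i).
  have [i iJ ix] := hJ x xD; exists i => //; exact: ismin_inj ix (hm i).
have /injectivePn [a [b nab mab]] : ~~ injectiveb m.
  apply/negP => /injectiveP inj; have := card_imset setT inj.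
  rewrite imE ?cardsT -?cD; first by move=> /eqP; rewrite eqn_leq ltnn andbF.
  by move=> x /(dominant_ismin dD)[i]; exists i.
have dbl c d : c != d -> m c = m d -> doubled c D.
  move=> ncd e; apply/forall_inP => x xD; apply/existsP.
  have [i ix] := dominant_ismin dD xD.
  have [ei|ni] := eqVneq i c; last by exists i; rewrite ni.
  exists d; rewrite eq_sym ncd /=; rewrite ei in ix.
  by rewrite (ismin_inj ix (hm c)) e hm.
exists a, b; split => //.
- exact: (dbl a b).
- by apply: (dbl b a); rewrite // eq_sym.
- by exists (m a); rewrite // mab.
move=> c /forall_inP hc.
have /imset_injP inj : #|m @: [set~ c]| == #|[set~ c]|.
  rewrite imE ?cardsC1 -?cD // => x /hc/existsP[i /andP[ic ix]].
  by exists i; rewrite ?inE.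
have [->|nca] := eqVneq c a; first by left.
have [->|ncb] := eqVneq c b; first by right.
by case/eqP: nab; apply: inj; rewrite ?inE 1?eq_sym.
Qed.

(** * Slack elements and the parity argument *)

Section Slack.
(** [slack i] stands for the facet of the simplex where coordinate [i] vanishes; its ranks mimic a
    vector that is lowest in coordinate [i] and huge in all others. *)
Variables (slack : I -> X).
Hypothesis slack_min : forall i x, r i (slack i) <= r i x.
Hypothesis slack_max : forall i j x, i != j -> x \notin codom slack ->
  r i x < r i (slack j).
Variable (color : X -> I).
Hypothesis color_slack : forall i, color (slack i) = i.
Variable (x0 : X).
Hypothesis x0_slack : x0 \notin codom slack.

Definition room A := dominant A && (#|A| == #|I|).

(** By cardinality, each color other than [i0] occurs exactly once in [D]. *)
Definition typed i0 D := [&& dominant D, #|D|.+1 == #|I| & color @: D == [set~ i0]].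

Lemma slack_inj : injective slack.
Proof. exact: can_inj color_slack. Qed.

(** Rooms through [D] correspond to the entering elements of its doubled orders, at most one for
    each. A non-slack element of [D] makes [slack c] a candidate for both doubled orders [c], which
    gives two rooms, distinct because [D] is dominant. If [D] consists of slack elements, only the
    order [i0] yields a room. *)
Lemma odd_rooms_of_door i0 D : typed i0 D ->
  odd #|[set y | (y \notin D) && dominant (y |: D)]| =
  (D == slack @: [set~ i0]).
Proof.
move=> /and3P[dD /eqP cD /eqP colD]; case: eqP => [D0|nD0].
  suff [z ->] : exists z, [set y | (y \notin D) && dominant (y |: D)] = [set z].
    by rewrite cards1.
  have c0 : candidate i0 x0 D.
    apply/forallP => i; apply/implyP => ni; apply/belowP; exists (slack i).
      by rewrite D0 imset_f // !inE.
    have := slack_min i x0; rewrite leq_eqVlt => /orP[/eqP/r_inj e|//].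
    by case/negP: x0_slack; rewrite -e codom_f.
  have [z ez] := entering_ex c0; exists z.
  have d0 : doubled i0 D.
    apply/forall_inP => x; rewrite D0 => /imsetP[j]; rewrite !inE => nj ->.
    apply/existsP; exists j; rewrite nj /ismin imset_f ?inE //=.
    by apply/nbelowP => y _.
  apply/setP => y; rewrite !inE; apply/andP/eqP => [[yD dA]|->]; last first.
    exact: entering_room ez.
  have [a [da ea]] := room_entering cD yD dA.
  have [e|na] := eqVneq a i0; first by rewrite e in ea; apply: entering_inj ea ez.
  case/andP: ea => /forallP/(_ i0); rewrite eq_sym na /= => /belowP[x].
  rewrite D0 => /imsetP[j]; rewrite !inE => nj -> lt _; exfalso.
  case yS : (y \in codom slack); last first.
    have := @slack_max i0 j y; rewrite eq_sym nj yS => /(_ isT isT).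
    by rewrite ltnNge ltnW.
  move/codomP: yS yD lt => [k ->]; have [->|nk] := eqVneq k i0.
    by rewrite ltnNge slack_min.
  by rewrite D0 imset_f // !inE.
have [t tD tS] : exists2 t, t \in D & t \notin codom slack.
  apply/exists_inP; rewrite -[[exists x in _, _]]negbK negb_exists_in.
  apply/negP => /forall_inP H.
  case: nD0; apply/setP => x; apply/idP/imsetP => [xD|[j]].
    have := H x xD; rewrite negbK => /codomP[j e]; exists j => //.
    have : color x \in color @: D by rewrite imset_f.
    by rewrite colD e color_slack.
  rewrite -colD => /imsetP[y yD ->] ->.
  have := H y yD; rewrite negbK => /codomP[k e]; by rewrite e color_slack -e.
have [a [b [nab da db [x xa xb] dbl]]] := door_doubled dD cD tD.
have enter c d : c != d -> ismin c x D -> ismin d x D -> exists z, entering c z D.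
  move=> ncd /andP[xD /nbelowP xc] /andP[_ /nbelowP xd].
  apply: (@entering_ex c (slack c)).
  apply/forallP => i; apply/implyP => ni; apply/belowP; exists t => //.
  exact: slack_max.
have [ya ea] := enter a b nab xa xb.
have [yb eb] : exists z, entering b z D by apply: (enter b a); rewrite // eq_sym.
have nyab : ya != yb.
  apply/eqP => e; apply: (@dominantF D ya dD) => i.
  case/andP: ea eb => /forallP/(_ i)/implyP ca _; rewrite -e.
  move=> /andP[/forallP/(_ i)/implyP cb _].
  have [ei|/ca//] := eqVneq i a; apply: cb; by rewrite ei.
rewrite (_ : [set _ | _] = [set ya; yb]) ?cards2 ?nyab //.
apply/setP => y; rewrite !inE; apply/andP/orP => [[yD dA]|[]/eqP->]; last first.
- exact: entering_room eb.
- exact: entering_room ea.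
have [c [dc ec]] := room_entering cD yD dA.
have [e|e] := dbl c dc; rewrite e in ec.
  by left; apply/eqP; apply: entering_inj ec ea.
by right; apply/eqP; apply: entering_inj ec eb.
Qed.

(** If removing [y] leaves a typed door, then [y] repeats the color of exactly one other element
    [z], and [y] and [z] are the only elements whose removal leaves such a door. *)
Lemma even_doors_of_room i0 A : room A -> color @: A != setT ->
  ~~ odd #|[set y in A | typed i0 (A :\ y)]|.
Proof.
move=> /andP[dA /eqP cA] ncol.
have [->|/set0Pn[y]] := eqVneq [set y in A | typed i0 (A :\ y)] set0.
  by rewrite cards0.
rewrite inE => /andP[yA /and3P[_ _ /eqP coly]].
have cy : color y != i0.
  apply: contra ncol => /eqP e; rewrite -(setD1K yA) imsetU1 coly e.
  by apply/eqP/setP => j; rewrite !inE orbN.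
have cAy : #|A :\ y|.+1 = #|I| by rewrite -cA (cardsD1 y A) yA.
have /imset_injP injy : #|color @: (A :\ y)| == #|A :\ y|.
  by rewrite coly cardsC1 -cAy.
have /imsetP[z zAy e] : color y \in color @: (A :\ y) by rewrite coly !inE.
move: (zAy); rewrite !inE => /andP[nzy zA].
rewrite (_ : [set _ in _ | _] = [set y; z]) ?cards2 1?eq_sym ?nzy //.
have typ t : t \in A -> color @: (A :\ t) = [set~ i0] -> typed i0 (A :\ t).
  move=> tA ct; apply/and3P; split; last exact/eqP.
  - by apply: dominantS dA; apply: subsetDl.
  - by rewrite -cA (cardsD1 t A) tA.
apply/setP => t; rewrite !inE; apply/andP/orP => [[tA tt]|[]/eqP->]; last first.
- split=> //; apply: typ => //; rewrite -coly; apply/setP => j.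
  apply/imsetP/imsetP => -[s]; rewrite !inE => /andP[ns sA] ->.
    have [es|nsy] := eqVneq s y; first by exists z; rewrite // es.
    by exists s; rewrite // !inE nsy.
  have [es|nsz] := eqVneq s z; first by exists y; rewrite ?es -?e // !inE eq_sym nzy.
  by exists s; rewrite // !inE nsz.
- by split=> //; apply: typ.
have [->|nty] := eqVneq t y; [by left | right].
case/and3P: tt => _ _ /eqP colt; apply/eqP.
have : color t \in color @: A by apply: imset_f.
have /imsetP[s] : color t \in color @: (A :\ t).
  rewrite colt -coly; apply: imset_f; by rewrite !inE nty.
rewrite !inE => /andP[nst sA] est _.
have [esy|nsy] := eqVneq s y.
  by apply: injy; rewrite ?inE ?nty ?nzy //= est esy.
by move: nst; rewrite (injy s t) ?eqxx ?inE ?nsy ?nty.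
Qed.

(* Double counting of the pairs (typed door, room): a non-colorful room has an
   even number of typed doors, and every typed door lies in two rooms, except the
   one made of slack elements, which lies in one. *)
Lemma colorful_dominant_set : exists A, [/\ dominant A, #|A| = #|I| & color @: A = setT].
Proof.
have [i0 _] : exists i0 : I, true by exists (color x0).
pose D0 := slack @: [set~ i0].
have typ0 : typed i0 D0.
  apply/and3P; split.
  - apply/dominantP => y; case yS : (y \in codom slack).
      move/codomP: yS => [k ->]; exists k; apply/nbelowP => x _; exact: slack_min.
    exists i0; apply/nbelowP => x /imsetP[j]; rewrite !inE => nj ->.
    by apply: ltnW; apply: slack_max; rewrite ?yS // eq_sym.
  - rewrite card_imset ?cardsC1; last exact: slack_inj.
    by rewrite prednK //; apply/card_gt0P; exists i0.
  - by rewrite /D0 -imset_comp (eq_imset _ (color_slack : _ =1 id)) imset_id.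
suff [A [/andP[dA /eqP cA] /eqP eA]] : exists A, room A /\ color @: A == setT.
  by exists A.
case: (pickP (fun A => room A && (color @: A == setT))) => [A /andP[]|no].
  by exists A.
pose rel := [set p : {set X} * X | [&& typed i0 p.1, p.2 \notin p.1 & dominant (p.2 |: p.1)]].
have card1 : #|rel| = \sum_(D | typed i0 D) #|[set y | (y \notin D) && dominant (y |: D)]|.
  rewrite -sum1_card (eq_bigl (fun p => typed i0 p.1 &&
      ((p.2 \notin p.1) && dominant (p.2 |: p.1)))).
    rewrite -(pair_big_dep (fun D => typed i0 D)
      (fun D y => (y \notin D) && dominant (y |: D)) (fun _ _ => 1)) /=.
    apply: eq_bigr => D _; rewrite sum1_card; apply: eq_card => y; by rewrite inE.
  by move=> p; rewrite inE.
pose rel' := [set p : {set X} * X | room p.1 && ((p.2 \in p.1) && typed i0 (p.1 :\ p.2))].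
have card2 : #|rel'| = \sum_(A | room A) #|[set y in A | typed i0 (A :\ y)]|.
  rewrite -sum1_card (eq_bigl (fun p => room p.1 &&
      ((p.2 \in p.1) && typed i0 (p.1 :\ p.2)))).
    rewrite -(pair_big_dep (fun D => room D)
      (fun D y => (y \in D) && typed i0 (D :\ y)) (fun _ _ => 1)) /=.
    apply: eq_bigr => D _; rewrite sum1_card; apply: eq_card => y; by rewrite inE.
  by move=> p; rewrite inE.
have eqrel : #|rel| = #|rel'|.
  have -> : rel' = (fun p => (p.2 |: p.1, p.2)) @: rel.
    apply/setP => -[A y]; rewrite inE; apply/andP/imsetP => /=.
      move=> [/andP[dA cA] /andP[yA tA]]; exists (A :\ y, y); last by rewrite setD1K.
      by rewrite inE /= tA setD1K // !inE eqxx.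
    move=> [[D z]]; rewrite inE /= => /and3P[tD zD dA] [-> ->].
    rewrite !inE eqxx setU1K //= tD /room dA cardsU1 zD add1n.
    by case/and3P: tD => _ ->.
  rewrite card_in_imset // => -[D y] [D' y'] /=; rewrite !inE /=.
  move=> /and3P[_ yD _] /and3P[_ yD' _] [e ey]; subst y'; congr (_, _).
  by rewrite -(setU1K yD) e setU1K.
(* Counted by rooms, the pairs are even in number, as no room is colorful; counted by doors they are
   odd in number, because of [D0]. *)
suff : odd #|rel|.
  suff /negPf -> : ~~ odd #|rel| by [].
  rewrite eqrel card2; elim/big_rec: _ => // A n rA on.
  rewrite oddD (negPf (even_doors_of_room _ rA _)) //.
  by apply/negP => eA; have := no A; rewrite rA eA.
rewrite card1 (bigD1 D0) //= oddD (odd_rooms_of_door typ0) eqxx /=.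
elim/big_rec: _ => // D n /andP[tD nD] on.
by rewrite oddD (odd_rooms_of_door tD) (negPf nD).
Qed.

End Slack.
End IndexedOrders.

(** * Scarf's lemma on the integer grid of a simplex *)

Definition near_corner (I : finType) (N : nat) (m k : I -> nat) :=
  \sum_i k i = N /\ forall i, m i <= k i <= m i + #|I|.

(** Grid points, ranked in order [i] by their coordinate [i], are joined by slack elements. A
    colorful room supplies points with the required labels, and its coordinatewise minima supply
    [m]. *)
Lemma grid_labelling (I : finType) (N : nat) (label : (I -> nat) -> I) :
  exists m : I -> nat, (exists k, near_corner N m k) /\
    forall i, 0 < m i -> exists2 k, near_corner N m k & label k = i.
Proof.
pose P (k : {ffun I -> 'I_N.+1}) := \sum_i k i == N.
pose K := {k | P k}.
pose co (k : K) i : nat := val k i.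
have co_sum k : \sum_i co k i = N by apply/eqP; apply: (valP k).
have co_surj (g : I -> nat) : \sum_i g i = N -> exists k, forall i, co k i = g i.
  move=> sg; have gN i : g i < N.+1 by rewrite ltnS -sg (bigD1 i) //= leq_addr.
  have sk : P [ffun i => Ordinal (gN i)].
    by rewrite /P -[X in _ == X]sg; apply/eqP/eq_bigr => i _; rewrite ffunE.
  by exists (exist P _ sk) => i; rewrite /co /= ffunE.
pose M := #|{: K}|.+1.
(* Ties between grid points are broken by [enum_rank], which stays below [M]. A slack element comes
   after all grid points except in its own order, where the rank 0 is reserved for it. *)
pose r (i : I) (x : K + I) : nat := match x with
  | inl k => (co k i * M + enum_rank k).+1
  | inr j => if j == i then 0 else (N.+1 * M + enum_rank j).+1 end.
have rkM (k : K) : enum_rank k < M by apply: ltnW; rewrite ltnS ltn_ord.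
have rlt k i : (co k i * M + enum_rank k).+1 < (N.+1 * M).+1.
  rewrite ltnS; apply: (@leq_trans ((co k i).+1 * M)); last first.
    by rewrite leq_mul2r ltn_ord orbT.
  by rewrite mulSn addnC ltn_add2r.
have r_mono k k' i : co k i < co k' i -> r i (inl k) < r i (inl k').
  move=> lt; rewrite /= ltnS; apply: (@leq_trans ((co k i).+1 * M)).
    by rewrite mulSn addnC ltn_add2r.
  by apply: (leq_trans _ (leq_addr _ _)); rewrite leq_mul2r lt orbT.
have r_inj i : injective (r i).
  move=> [k|j] [k'|j'] //=.
  - move=> [] /(congr1 (modn^~ M)); rewrite !modnMDl !modn_small // => /val_inj.
    by move/enum_rank_inj->.
  - by case: eqP => // _ e; have := rlt k i; rewrite e ltnS leqNgt ltnS leq_addr.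
  - by case: eqP => // _ e; have := rlt k' i; rewrite -e ltnS leqNgt ltnS leq_addr.
  case: eqP => [->|_]; case: eqP => [->|_] //.
  by move=> [] /addnI /val_inj/enum_rank_inj ->.
have cod x : x \notin codom (inr : I -> K + I) -> exists k, x = inl k.
  case: x => [k _|j]; [by exists k | by rewrite codom_f].
pose color (x : K + I) := match x with inl k => label (co k) | inr j => j end.
have [i0 _] : exists i0 : I, true by exists (label (fun=> 0)).
have [k0 _] : exists k0, forall i, co k0 i = if i == i0 then N else 0.
  by apply: co_surj; rewrite -big_mkcond big_pred1_eq.
have k0_slack : inl k0 \notin codom (inr : I -> K + I).
  by apply/negP => /codomP[].
have slack_min i x : r i (inr i) <= r i x by rewrite /= eqxx.
have slack_max i j x : i != j -> x \notin codom (inr : I -> K + I) ->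
    r i x < r i (inr j).
  move=> nij /cod[k ->] /=; rewrite eq_sym (negPf nij).
  by apply: leq_trans (rlt k i) _; rewrite ltnS leq_addr.
have [A [dA cA colA]] := colorful_dominant_set r_inj slack_min slack_max
  (fun i => erefl : color (inr i) = i) k0_slack.
(* For [j] in [C] the color [j] must come from a grid point of [A]. Off [C], [m] will be 0, so no
   label is asked for there. *)
pose C := [set j | inr j \notin A].
have Ccol j : j \in C -> exists2 k, inl k \in A & label (co k) = j.
  rewrite inE => jA; have : j \in color @: A by rewrite colA inE.
  by move=> /imsetP[[k|j'] xA e]; [exists k | rewrite /= in e; rewrite e xA in jA].
have /fin_all_exists[m hm] : forall j, exists mj, [/\ j \notin C -> mj = 0,
    j \in C -> exists2 k, inl k \in A & co k j = mj &
    forall k, inl k \in A -> mj <= co k j].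
  move=> j; case: (boolP (j \in C)) => jC; last by exists 0.
  have [k kA _] := Ccol j jC.
  case: (@arg_minnP _ k (fun k => inl k \in A) (fun k => co k j) kA) => k1 k1A k1m.
  by exists (co k1 j); split => // _; exists k1.
have [j1 j1C] : exists j1, j1 \in C.
  apply/existsP; rewrite -[[exists j, _]]negbK; apply/negP => /existsPn H.
  have /dominantP/(_ (inl k0))[i /nbelowP] := dA.
  have iA : inr i \in A by have := H i; rewrite inE negbK.
  by move=> /(_ _ iA); rewrite /= eqxx.
(* Otherwise the grid point with coordinates [m j + 1] on [C], the surplus being added at [j1], and
   0 elsewhere would exceed the minimum of [A] in every order: a minimizing grid point shows this on
   [C], the slack element off [C]. *)
have sumC : N < \sum_(j in C) (m j).+1.
  rewrite ltnNge; apply/negP => le.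
  pose y j := if j \in C then (m j).+1 + (if j == j1 then N - \sum_(j in C) (m j).+1 else 0)
    else 0.
  have [k hk] : exists k, forall i, co k i = y i.
    apply: co_surj; rewrite -big_mkcond big_split /= -big_mkcondr /=.
    rewrite [X in _ + X](big_pred1 j1) ?subnKC // => j.
    by rewrite /= andbC; case: eqP => // ->.
  apply: (@dominantF _ _ _ A (inl k) dA) => i; apply/belowP.
  have [mi0 mi1 _] := hm i.
  case: (boolP (i \in C)) => iC; last first.
    by exists (inr i); rewrite ?inE ?negbK /= ?eqxx //; rewrite inE negbK in iC.
  have [k' k'A e] := mi1 iC; exists (inl k') => //; apply: r_mono.
  by rewrite hk e /y iC; lia.
(* The sum of [m] falls short of [N] by less than [#|C|], which bounds the excess of any single
   coordinate over [m]. *)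
have near k : inl k \in A -> near_corner N m (co k).
  move=> kA; split=> // i; have mk j : m j <= co k j by case: (hm j) => _ _ ->.
  rewrite mk /=.
  have e : \sum_j m j + \sum_j (co k j - m j) = N.
    rewrite -big_split /= -[RHS](co_sum k); apply: eq_bigr => j _; exact: subnKC.
  have eC : \sum_(j in C) (m j).+1 = \sum_j m j + #|C|.
    rewrite (eq_bigr (fun j => m j + 1)) => [|j _]; last by rewrite addn1.
    rewrite big_split /= sum1_card; congr (_ + _).
    rewrite [RHS](bigID (mem C)) /= [X in _ = _ + X]big1 ?addn0 // => j nj.
    by case: (hm j) => ->.
  rewrite -leq_subLR; apply: (@leq_trans (\sum_j (co k j - m j))).
    by rewrite (bigD1 i) //= leq_addr.
  apply: leq_trans (max_card (mem C)); rewrite -(leq_add2l (\sum_j m j)) e -eC.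
  exact: ltnW.
exists m; split.
  by have [k kA _] := Ccol j1 j1C; exists (co k); apply: near.
move=> i mi; case: (boolP (i \in C)) => iC; last by case: (hm i) mi => ->.
by have [k kA e] := Ccol i iC; exists (co k) => //; apply: near.
Qed.

From mathcomp Require Import lra ring.
From mathcomp Require Import boolp classical_sets functions filter reals topology.
From mathcomp Require Import function_spaces normedtype sequences derive exp.
Import Order.TTheory GRing.Theory Num.Theory.
Import numFieldNormedType.Exports.
Local Open Scope ring_scope.

(** * A covering lemma for the simplex *)

Section Topology.
Local Open Scope classical_set_scope.

Lemma ptws_cvg (T : eqType) (V : topologicalType) (I : Type) (F : set_system I) {FF : Filter F}
    (f : I -> {ptws T -> V}) (g : {ptws T -> V}) :
  (forall t, f x t @[x --> F] --> g t) -> f x @[x --> F] --> g.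
Proof.
move=> h; apply/cvg_sup => t.
move=> A; rewrite nbhsE => -[_ [[C oC <-] Cg] CA].
apply: filterS CA _; apply: h; exact: open_nbhs_nbhs.
Qed.

Definition simplex (R : realType) (T : finType) : set {ptws T -> R} :=
  [set s | (forall i, 0 <= s i) /\ \sum_i s i = 1].

Lemma cvg_sum (R : realType) (J : finType) (I : Type) (F : set_system I)
    {FF : Filter F} (P : pred J) (f : J -> I -> R) (l : J -> R) :
  (forall j, P j -> f j x @[x --> F] --> l j) ->
  \sum_(j | P j) f j x @[x --> F] --> \sum_(j | P j) l j.
Proof. by apply: cvg_big; exact: add_continuous. Qed.

Lemma fmap_ultra (I J : Type) (f : I -> J) (F : set_system I) :
  UltraFilter F -> UltraFilter (f @ F).
Proof.
move=> FU; have FP : ProperFilter F by exact: ultra_proper.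
split; first exact: fmap_proper_filter.
move=> G GP FG; apply/seteqP; split=> // A GA; rewrite /= /fmap.
have [//|FCA] := in_ultra_setVsetC (f @^-1` A) FU.
have [] : ~ G set0 by exact: filter_not_empty.
by rewrite -(setICr A); apply: filterI => //; apply: FG.
Qed.

(** Each grid point is labelled by a set containing it. The labelling lemma gives clusters of grid
    points whose coordinates differ by at most a multiple of the mesh; their common limit [z] stays
    in the closed sets. *)
Lemma simplex_covering (R : realType) (T : finType) (t0 : T)
    (P : T -> set {ptws T -> R}) :
  (forall i, closed (P i)) -> (forall s, simplex s -> exists i, P i s) ->
  exists2 z, simplex z & forall i, 0 < z i -> P i z.
Proof.
move=> closedP coverP.
pose pt N (k : T -> nat) : {ptws T -> R} := fun j => (k j)%:R / N.+1%:R.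
pose label N k := xget t0 [set i | P i (pt N k)].
have labelP N k : (\sum_i k i = N.+1)%N -> P (label N k) (pt N k).
  move=> sk; apply: (@xgetPex _ t0 [set i | P i (pt N k)]); apply: coverP; split.
    by move=> i; rewrite divr_ge0.
  by rewrite -mulr_suml -natr_sum sk divff // pnatr_eq0.
have /boolp.choice[g hg] : forall N, exists y : (T -> nat) * (T -> nat) * (T -> T -> nat),
    near_corner N.+1 y.1.1 y.1.2 /\ forall i, near_corner N.+1 y.1.1 (y.2 i) /\
      ((0 < y.1.1 i)%N -> P i (pt N (y.2 i))).
  move=> N; have [m [[k nk] hm]] := grid_labelling N.+1 (label N).
  have /fin_all_exists[x hx] : forall i, exists xi, near_corner N.+1 m xi /\
      ((0 < m i)%N -> P i (pt N xi)).
    move=> i; case: (posnP (m i)) => [_|mi]; first by exists k.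
    by have [xi nx <-] := hm i mi; exists xi; split=> // _; apply: labelP; case: nx.
  by exists (m, k, x).
pose m N := (g N).1.1; pose k N := (g N).1.2; pose x i N := (g N).2 i.
(* Along an ultrafilter finer than [\oo] all bounded real sequences converge, so no successive
   subsequences are needed. *)
have [U [UU ooU]] := @ultraFilterLemma nat \oo _.
have UF : ProperFilter U by exact: ultra_proper.
have le_m N i : 0 <= pt N (m N) i <= 1.
  have [[sk /(_ i) /andP[mk _]] _] := hg N; rewrite divr_ge0 //=.
  rewrite ler_pdivrMr ?ltr0n // mul1r ler_nat (leq_trans mk) //.
  by rewrite -sk (bigD1 i) //= leq_addr.
have /fin_all_exists[z hz] : forall i, exists zi : R, pt N (m N) i @[N --> U] --> zi.
  move=> i; have := @segment_compact R 0 1.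
  rewrite compact_ultra => /(_ (pt N (m N) i @[N --> U]) (@fmap_ultra _ _ _ _ UU)) [].
    apply: (@filterS _ U _ setT _ _ filterT) => N _.
    by rewrite /= in_itv /=; exact: le_m.
  by move=> zi [_ zP]; exists zi.
have near_cvg (y : nat -> T -> nat) : (forall N, near_corner N.+1 (m N) (y N)) ->
    forall j, pt N (y N) j @[N --> U] --> z j.
  move=> ny j.
  apply: (@squeeze_cvgr _ _ _ _ (fun N => pt N (m N) j)
    (fun N => pt N (m N) j + #|T|%:R * harmonic N)) => //.
    apply: (@filterS _ U _ setT _ _ filterT) => N _; have [_ /(_ j)/andP[h1 h2]] := ny N.
    have c0 : 0 <= N.+1%:R^-1 :> R by rewrite invr_ge0.
    by rewrite /pt /harmonic /= -mulrDl -natrD !ler_wpM2r ?ler_nat.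
  have -> : z j = z j + #|T|%:R * 0 by rewrite mulr0 addr0.
  apply: cvgD => //; apply: cvgM; first exact: cvg_cst.
  by move=> A /cvg_harmonic; exact: ooU.
have nk N : near_corner N.+1 (m N) (k N) by case: (hg N).
have sz : \sum_i z i = 1.
  have h : \sum_i pt N (k N) i @[N --> U] --> \sum_i z i.
    by apply: cvg_sum => i _; exact: near_cvg nk i.
  apply: (cvg_unique _ h); first exact: norm_hausdorff.
  rewrite (_ : (fun _ => _) = cst 1); first exact: cvg_cst.
  apply/funext => N; rewrite -mulr_suml -natr_sum.
  by case: (nk N) => -> _; rewrite divff // pnatr_eq0.
exists z; first split=> // i.
  apply: (@closed_cvg _ _ U _ _ _ (@closed_ge R 0) _ _ (hz i)).
  by apply: (@filterS _ U _ setT _ _ filterT) => N _ /=; rewrite divr_ge0.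
move=> i zi.
have nx N : near_corner N.+1 (m N) (x i N) by case: (hg N) => _ /(_ i)[].
apply: (@closed_cvg _ _ U _ (fun N => pt N (x i N)) _ (closedP i)); last first.
  by apply: ptws_cvg => j; exact: near_cvg nx j.
(* As [0 < z i], the corner has a positive coordinate [i] for [U]-almost all [N], which is when the
   point [x i N] is known to lie in [P i]. *)
apply: (@filterS _ U _ _ _ _ (cvgr_gt _ (hz i) _ zi)) => N /= mN.
have [_ /(_ i)[_ ]] := hg N; apply.
by rewrite lt0n; apply: contraTneq mN => m0; rewrite /pt /m m0 mul0r ltxx.
Qed.

(** * Zeros of fields with prescribed boundary signs *)

(** The covering sets are chosen so that the point found is a zero: a positive coordinate in [S]
    gives [0 <= G x] unless the point lies in [A], and a positive coordinate off [S] gives [B] and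
    [G x <= 0] for all [x] in [S]. [Gface] rules out a point without mass off [S], [G0] a vanishing
    coordinate in [S], and [Gint] a point of [A]. *)
Lemma simplex_zero (R : realType) (T : finType) (S : {set T}) (x0 y0 : T)
    (A B : set {ptws T -> R}) (G : T -> {ptws T -> R} -> R) :
  x0 \in S -> y0 \notin S -> closed A -> closed B -> (forall s, A s \/ B s) ->
  (forall x, x \in S -> continuous (G x)) ->
  (forall s x, simplex s -> x \in S -> B s -> s x = 0 -> 0 < G x s) ->
  (forall s, simplex s -> (forall y, y \notin S -> s y = 0) ->
     ~ A s /\ exists x, [/\ x \in S, 0 < s x & G x s < 0]) ->
  (forall s, simplex s -> A s -> B s -> exists2 x, x \in S & 0 < G x s) ->
  exists s, [/\ simplex s, B s & forall x, x \in S -> G x s = 0].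
Proof.
move=> x0S y0S clA clB AB cG G0 Gface Gint.
pose neg := \bigcap_(x in [set` S]) (G x @^-1` [set r | r <= 0]).
pose P x : set {ptws T -> R} :=
  if x \in S then A `|` (G x @^-1` [set r | 0 <= r]) else B `&` neg.
have clG x (D : set R) : x \in S -> closed D -> closed (G x @^-1` D).
  by move=> xS clD; move/continuous_closedP: (cG x xS); apply.
have clP x : closed (P x).
  rewrite /P; case: ifP => xS.
    by apply: closedU => //; apply: clG => //; exact: closed_ge.
  apply: closedI => //; apply: closed_bigI => y /= yS.
  by apply: clG => //; exact: closed_le.
have [s ss|z sz Pz] := simplex_covering y0 clP.
  have [As|nAs] := pselect (A s).
    by exists x0; rewrite /P x0S; left.
  have {AB}Bs : B s by case: (AB s).
  have [[x [xS xG]]|nG] := pselect (exists x, x \in S /\ 0 <= G x s).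
    by exists x; rewrite /P xS; right.
  exists y0; rewrite /P (negPf y0S); split=> // y yS /=.
  by rewrite leNgt; apply/negP => /ltW Gy; apply: nG; exists y.
have [z0|] := pselect (forall y, y \notin S -> z y = 0).
  have [nA [x [xS zx Gx]]] := Gface z sz z0.
  by have := Pz x zx; rewrite /P xS => -[//|/=]; rewrite leNgt Gx.
move=> /existsNP[y /not_implyP[yS /eqP zy]].
have zy0 : 0 < z y by rewrite lt_neqAle eq_sym zy; case: sz => ->.
have := Pz y zy0; rewrite /P (negPf yS) => -[Bz negz].
exists z; split=> // x xS; apply/eqP; rewrite eq_le; apply/andP; split.
  exact: negz.
have zx : 0 < z x.
  rewrite lt_neqAle; case: (sz) => -> _; rewrite andbT eq_sym.
  by apply/eqP => zx; have := negz x xS; rewrite /= leNgt G0.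
have := Pz x zx; rewrite /P xS => -[Az|//].
by have [t tS Gt] := Gint z sz Az Bz; have := negz t tS; rewrite /= leNgt Gt.
Qed.

(** * Box and shell parametrized by the simplex *)

Section Box.
Variables (R : realType) (T : finType) (S : {set T}) (x0 y0 : T) (c : R).
Hypotheses (x0S : x0 \in S) (y0S : y0 \notin S) (c_gt0 : 0 < c).

(** A floor for the denominator of [ratio], which keeps it continuous where all coordinates in [S]
    vanish. *)
Let delta : R := (2 * #|T|%:R)^-1.
Let top (s : {ptws T -> R}) : R := \big[Num.max/0]_(x in S) s x.
Let outer (s : {ptws T -> R}) : R := \sum_(x | x \notin S) s x.

Let ratio (K : R) (s : {ptws T -> R}) : R :=
  c * (1 + K * outer s) / Num.max (top s) delta.
(* Radially [outer s], running through [0, 1/2], becomes the size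
   [c * (1 + K * outer s)] of [chart K s]. *)
Let chart (K : R) (s : {ptws T -> R}) : {ptws T -> R} := fun x =>
  if x \in S then s x * ratio K s else 0.

Let delta_gt0 : 0 < delta.
Proof.
rewrite invr_gt0 mulr_gt0 ?ltr0n //; apply/card_gt0P; by exists y0.
Qed.

Let coord_continuous x : continuous (fun s : {ptws T -> R} => s x).
Proof. exact: (@proj_continuous T (fun=> R) x). Qed.

Let outer_continuous : continuous outer.
Proof.
apply: continuous_big => [|x _]; last exact: coord_continuous.
exact: add_continuous.
Qed.

Let top_continuous : continuous top.
Proof.
apply: continuous_big => [|x _]; last exact: coord_continuous.
by move=> p; apply: (@continuous_max _ _ fst snd); [exact: cvg_fst | exact: cvg_snd].
Qed.

Let ratio_continuous K : continuous (ratio K).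
Proof.
move=> s.
have cKo : (K * outer x) @[x --> s] --> K * outer s.
  exact: cvgM (cvg_cst K) (@outer_continuous s).
have c1Ko : (1 + K * outer x) @[x --> s] --> 1 + K * outer s.
  exact: (@cvgD R R _ (nbhs s) _ (fun=> 1) (fun x => K * outer x) 1 _ (cvg_cst _) cKo).
have cd : {for s, continuous (cst delta : {ptws T -> R} -> R)}.
  exact: cst_continuous.
have ctd : Num.max (top x) delta @[x --> s] --> Num.max (top s) delta.
  exact: (@continuous_max R {ptws T -> R} top (cst delta) s (@top_continuous s) cd).
have cV : (Num.max (top x) delta)^-1 @[x --> s] --> (Num.max (top s) delta)^-1.
  by apply: (cvgV _ ctd); rewrite gt_eqF // lt_max delta_gt0 orbT.
exact: cvgM (cvgM (cvg_cst c) c1Ko) cV.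
Qed.

Let chart_continuous K : continuous (chart K).
Proof.
move=> s; apply: (@ptws_cvg T R _ (nbhs s) _ (chart K) (chart K s)) => x.
rewrite /chart; case: ifP => _; last exact: cvg_cst.
exact: cvgM (@coord_continuous x s) (@ratio_continuous K s).
Qed.

Let outer_ge0 s : simplex s -> 0 <= outer s.
Proof. by move=> [s0 _]; apply: sumr_ge0. Qed.

Let le_top s x : x \in S -> s x <= top s.
Proof. by move=> xS; apply: le_bigmax_cond. Qed.

Let chart_ge0 K s x : 0 <= K -> simplex s -> 0 <= chart K s x.
Proof.
move=> K0 ss; rewrite /chart /ratio; case: ifP => // _; apply: mulr_ge0; first by case: ss.
rewrite divr_ge0 // ?le_max ?(ltW delta_gt0) ?orbT // mulr_ge0 ?(ltW c_gt0) //.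
by rewrite addr_ge0 ?mulr_ge0 ?outer_ge0.
Qed.

Let chart_le K s x : 0 <= K -> simplex s -> chart K s x <= c * (1 + K * outer s).
Proof.
move=> K0 ss; have r0 : 0 <= c * (1 + K * outer s).
  by rewrite mulr_ge0 ?(ltW c_gt0) // addr_ge0 ?mulr_ge0 ?outer_ge0.
rewrite /chart /ratio; case: ifP => // xS.
have m0 : 0 < Num.max (top s) delta by rewrite lt_max delta_gt0 orbT.
by rewrite mulrCA ler_piMr // ler_pdivrMr // mul1r le_max le_top.
Qed.

(** Mass at least 1/2 on [S] forces [delta <= top s], so the floor in [ratio] is inactive and a
    largest coordinate attains the bound of [chart_le]. *)
Let chart_top K s : 0 <= K -> simplex s -> outer s <= 2^-1 ->
  exists x, [/\ x \in S, 0 < s x & chart K s x = c * (1 + K * outer s)].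
Proof.
move=> K0 [s0 s1] so.
have T0 : 0 < #|T|%:R :> R by rewrite ltr0n; apply/card_gt0P; exists y0.
have hS : 2^-1 <= \sum_(x in S) s x.
  have : \sum_(x in S) s x + outer s = 1 by rewrite -s1 [RHS](bigID (mem S)).
  by move: so; lra.
have dt : delta <= top s.
  have : \sum_(x in S) s x <= #|T|%:R * top s.
    apply: (@le_trans _ _ (\sum_(x in S) top s)); first by apply: ler_sum => x; exact: le_top.
    rewrite sumr_const -[leLHS]mulr_natl ler_wpM2r ?ler_nat ?max_card //.
    exact: bigmax_ge_id.
  move=> /(le_trans hS); rewrite mulrC -ler_pdivrMr // /delta invfM mulrC.
  by rewrite mulrC.
have [x1 x1S tx1] := @eq_bigmax _ _ T 0 x0 (mem S) s x0S (fun x _ => s0 x).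
rewrite -/(top s) in tx1.
exists x1; split=> //; first by rewrite -tx1 (lt_le_trans delta_gt0).
rewrite /chart /ratio x1S tx1 -tx1 max_l // mulrCA divff ?mulr1 //.
by rewrite gt_eqF // (lt_le_trans delta_gt0).
Qed.

Variable g : T -> {ptws T -> R} -> R.
Hypothesis g_continuous : forall x, x \in S -> continuous (g x).
Let admissible (u : {ptws T -> R}) :=
  (forall x, 0 <= u x) /\ (forall x, x \notin S -> u x = 0).
Hypothesis g_side : forall u x, admissible u -> x \in S -> u x = 0 -> 0 < g x u.
Hypothesis g_inner : forall u x, admissible u -> x \in S -> u x = c ->
  (forall y, u y <= c) -> g x u < 0.

Let chart_admissible K s : 0 <= K -> simplex s -> admissible (chart K s).
Proof.
move=> K0 ss; split=> [x|x xS]; first exact: chart_ge0.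
by rewrite /chart (negPf xS).
Qed.

Let g_chart_continuous K x : x \in S -> continuous (g x \o chart K).
Proof.
move=> xS s; apply: continuous_comp; first exact: chart_continuous.
exact: g_continuous.
Qed.

Let g_chart_face K s : 0 <= K -> simplex s -> (forall y, y \notin S -> s y = 0) ->
  exists x, [/\ x \in S, 0 < s x & g x (chart K s) < 0].
Proof.
move=> K0 ss s0; have o0 : outer s = 0 by rewrite /outer big1.
have le u := @chart_le K s u K0 ss; rewrite o0 mulr0 addr0 mulr1 in le.
have [|x [xS sx e]] := @chart_top K s K0 ss; first by rewrite o0 invr_ge0.
exists x; split=> //; apply: g_inner => //; first exact: chart_admissible.
by rewrite e o0 mulr0 addr0 mulr1.
Qed.

(** With [K = 0] the chart sends the simplex into the box, and the face without mass off [S] to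
    points of maximum [c], where [g_inner] applies. There is no outer end, so [A] is empty. *)
Lemma zero_in_box : exists u,
  [/\ admissible u, forall x, u x <= c & forall x, x \in S -> g x u = 0].
Proof.
have [|||||||s [ss _ gs]] :=
    @simplex_zero R T S x0 y0 set0 setT (fun x => g x \o chart 0) x0S y0S.
- exact: closed0.
- exact: closedT.
- by move=> s; right.
- by move=> x; exact: g_chart_continuous.
- move=> s x ss xS _ sx; apply: g_side => //; first exact: chart_admissible.
  by rewrite /chart xS sx mul0r.
- by move=> s ss s0; split=> //; exact: g_chart_face.
- by [].
exists (chart 0 s); split=> //; first exact: chart_admissible.
by move=> x; have := @chart_le 0 s x (lexx 0) ss; rewrite mul0r addr0 mulr1.
Qed.

Lemma zero_in_shell M : c < M ->
  (forall u x, admissible u -> x \in S -> u x = M -> (forall y, u y <= M) ->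
    0 < g x u) ->
  exists u, [/\ admissible u, exists2 x, x \in S & c <= u x &
    forall x, x \in S -> g x u = 0].
Proof.
(* With this [K] the size [c * (1 + K * outer s)] grows from [c] at [outer s = 0] to [M] at
   [outer s = 1/2]. *)
move=> cM g_outer; pose K := 2 * (M / c - 1).
have K0 : 0 <= K by rewrite mulr_ge0 // subr_ge0 ler_pdivlMr // mul1r ltW.
(* The two closed sets meet in the outer end of the shell, where [outer s = 1/2]; on the second one
   the chart has maximum at least [c]. *)
have [|||||||s [ss Bs gs]] := @simplex_zero R T S x0 y0
    (outer @^-1` [set r | 2^-1 <= r]) (outer @^-1` [set r | r <= 2^-1])
    (fun x => g x \o chart K) x0S y0S.
- by move/continuous_closedP: outer_continuous; apply; exact: closed_ge.
- by move/continuous_closedP: outer_continuous; apply; exact: closed_le.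
- by move=> s /=; case: (leP (outer s) 2^-1) => [|/ltW]; [right|left].
- by move=> x; exact: g_chart_continuous.
- move=> s x ss xS _ sx; apply: g_side => //; first exact: chart_admissible.
  by rewrite /chart xS sx mul0r.
- move=> s ss s0; split; last exact: g_chart_face.
  by rewrite /outer /= big1 // => /le_gtF; rewrite invr_gt0 ltr0n.
- move=> s ss /= h1 h2; have o : outer s = 2^-1 by apply/eqP; rewrite eq_le h1 h2.
  have e : c * (1 + K * outer s) = M.
    by rewrite o /K; field; rewrite gt_eqF.
  have [|x [xS sx eM]] := @chart_top K s K0 ss; first by rewrite o.
  exists x => //; apply: g_outer => //; first exact: chart_admissible.
    by rewrite eM.
  by move=> y; rewrite -e; exact: chart_le.
exists (chart K s); split=> //; first exact: chart_admissible.
have [x [xS _ e]] := @chart_top K s K0 ss Bs; exists x; rewrite // e.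
by rewrite ler_peMr ?(ltW c_gt0) // lerDl mulr_ge0 ?outer_ge0.
Qed.

End Box.

(** * The residual of the boundary value problem *)

(** Near 0 the factor [|t| ^ a] is at most 1 for nonzero [t], so the product is dominated by [|t|];
    away from 0 the power is differentiable. *)
Lemma powR_norm_mul_continuous (R : realType) (a : R) : 0 <= a ->
  continuous (fun d : R => `|d| `^ a * d).
Proof.
move=> a0 d; have [->|d0] := eqVneq d 0.
  rewrite /prop_for /continuous_at mulr0; apply/cvgrPdist_lt => e e0.
  near=> t; rewrite sub0r normrN normrM (ger0_norm (powR_ge0 _ _)).
  have t1 : `|t| < 1 by near: t; exact: (@pseudometric_normed_Zmodule.nbhs0_lt R R).
  have te : `|t| < e by near: t; exact: (@pseudometric_normed_Zmodule.nbhs0_lt R R).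
  apply: le_lt_trans te; have [->|t0] := eqVneq t 0; first by rewrite normr0 mulr0.
  by rewrite ler_piMl // -(powRr0 `|t|) ger_powR // normr_gt0 t0 ltW.
apply: (@cvgM _ _ _ _ (fun d => `|d| `^ a) id); last exact: cvg_id.
apply: (@continuous_comp R R R Num.norm (fun r => r `^ a)); first exact: norm_continuous.
apply: differentiable_continuous; apply/derivable1_diffP; apply: derivable_powR.
by rewrite in_itv /= normr_gt0 d0.
Unshelve. all: by end_near.
Qed.

Lemma mulr_norm_powR (R : realType) (a p : R) : 0 < a -> 2 <= p ->
  `|a| `^ (p - 2) * a = a `^ (p - 1).
Proof.
move=> a0 p2; rewrite gtr0_norm // mulrC -[RHS](mulr_powRB1 (ltW a0)); last by lra.
by congr (_ * _ `^ _); lra.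
Qed.

(** Since [d <= n] and [2 <= pm], the product of the powers of 2, [d] and [n] in the numerator is at
    most 1, and the subtracted term only lowers it; the denominator is at least
    [phi * gamma ^ m + psi * gamma]. *)
Lemma lambda3_bound (R : realType) (pm qm m phi psi gamma lambda : R) (n d k : nat) :
  (0 < d <= n)%N -> (0 < k)%N -> 2 <= pm -> 0 < qm -> 0 < phi -> 0 < psi ->
  0 < gamma -> 0 < lambda ->
  lambda < (qm * 2 `^ (- (pm / 2)) * d%:R `^ (pm / 2) * n%:R `^ (1 - pm)
     * gamma `^ pm - qm * k%:R)
    / ((phi * gamma `^ m + phi + psi * n%:R `^ (1 / 2) * gamma) * k%:R) ->
  lambda * (phi * gamma `^ m + psi * gamma) < qm * gamma `^ pm.
Proof.
move=> /andP[d0 dn] k0 pm2 q0 f0 s0 g0 l0.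
have n1 : 1 <= n%:R :> R by rewrite ler1n (leq_trans d0).
have k1 : 1 <= k%:R :> R by rewrite ler1n.
have gm0 := powR_gt0 m g0; have gp0 := powR_gt0 pm g0.
have nh1 : 1 <= n%:R `^ (1 / 2) :> R by rewrite -[leLHS](powRr0 n%:R) ler_powR // divr_ge0.
have D0 : 0 < phi * gamma `^ m + psi * gamma by rewrite addr_gt0 ?mulr_gt0.
have DD : phi * gamma `^ m + psi * gamma <=
    (phi * gamma `^ m + phi + psi * n%:R `^ (1 / 2) * gamma) * k%:R.
  have h : psi * gamma <= psi * n%:R `^ (1 / 2) * gamma.
    by rewrite -mulrA ler_pM2l // ler_peMl // ltW.
  apply: (@le_trans _ _ (phi * gamma `^ m + phi + psi * n%:R `^ (1 / 2) * gamma)).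
    by move: h f0; lra.
  by rewrite ler_peMr //; move: h f0 D0; lra.
rewrite ltr_pdivlMr; last exact: lt_le_trans DD.
move=> lt; apply: (@le_lt_trans _ _ _ _ _ (ler_wpM2l (ltW l0) DD)).
apply: (lt_le_trans lt).
have a1 : 2 `^ (- (pm / 2)) <= 1 :> R.
  by rewrite -[leRHS](powRr0 2) ler_powR ?ler1n // oppr_le0 divr_ge0 //; lra.
have be1 : d%:R `^ (pm / 2) * n%:R `^ (1 - pm) <= 1 :> R.
  apply: (@le_trans _ _ (n%:R `^ (pm / 2) * n%:R `^ (1 - pm))).
    by rewrite ler_wpM2r ?powR_ge0 // ge0_ler_powR ?nnegrE ?ler_nat // divr_ge0 //; lra.
  rewrite -powRD; last by rewrite (gt_eqF (lt_le_trans ltr01 n1)) implybT.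
  by rewrite -[leRHS](powRr0 n%:R) ler_powR //; lra.
apply: (@le_trans _ _ (qm * 2 `^ (- (pm / 2)) * d%:R `^ (pm / 2) * n%:R `^ (1 - pm)
     * gamma `^ pm)).
  by rewrite lerBlDr lerDl mulr_ge0 // ltW.
rewrite ler_wpM2r ?(ltW gp0) // -[leRHS]mulr1 -!mulrA ler_wpM2l ?(ltW q0) //.
by rewrite mulr_ile1 // ?mulr_ge0 ?powR_ge0.
Qed.

Section Field.
Variables (R : realType) (T : finType) (G : wgraph R T) (p q : T -> R)
  (f : T -> R -> R) (lambda : R).
Hypothesis p_ge2 : forall x, 2 <= p x.
Implicit Types (u : {ptws T -> R}) (x y : T).

Definition residual x u : R :=
  plaplacian G p u x - q x * `|u x| `^ (p x - 2) * u x + lambda * f x (u x).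

Let pm2_ge0 x : 0 <= p x - 2.
Proof. by rewrite subr_ge0. Qed.

Lemma residual_continuous x : continuous (f x) -> continuous (residual x).
Proof.
move=> cf u.
have cu y : (v y : R) @[v --> u] --> (u y : R).
  exact: (@proj_continuous T (fun=> R) y u).
have c1 : plaplacian G p v x @[v --> u] --> plaplacian G p u x.
  apply: (@cvg_sum R T {ptws T -> R} (nbhs u) (nbhs_filter u)) => y _.
  apply: cvgM; last exact: cvg_cst.
  apply: (@continuous_comp {ptws T -> R} R R (fun v => v y - v x)
    (fun d => `|d| `^ (p x - 2) * d)).
    exact: (@cvgB R R {ptws T -> R} (nbhs u) (nbhs_filter u)
      (fun v => v y) (fun v => v x) _ _ (cu y) (cu x)).
  exact: powR_norm_mul_continuous.
have c2 : `|v x| `^ (p x - 2) * v x @[v --> u] --> `|u x| `^ (p x - 2) * u x.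
  apply: (@continuous_comp {ptws T -> R} R R (fun v => v x)
    (fun d => `|d| `^ (p x - 2) * d)); first exact: cu.
  exact: powR_norm_mul_continuous.
have c3 : f x (v x) @[v --> u] --> f x (u x).
  apply: (@continuous_comp {ptws T -> R} R R (fun v => v x) (f x)); first exact: cu.
  exact: cf.
have c2' : q x * (`|v x| `^ (p x - 2) * v x) @[v --> u] -->
    q x * (`|u x| `^ (p x - 2) * u x) 
  by exact: (@cvgM R {ptws T -> R} (nbhs u) _ (fun=> q x)
    (fun v => `|v x| `^ (p x - 2) * v x) _ _ (cvg_cst _) c2).
have c3' : lambda * f x (v x) @[v --> u] --> lambda * f x (u x).
  exact: (@cvgM R {ptws T -> R} (nbhs u) _ (fun=> lambda) (fun v => f x (v x))
    _ _ (cvg_cst _) c3).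
have c12 := @cvgB R R {ptws T -> R} (nbhs u) (nbhs_filter u)
  (fun v => plaplacian G p v x) (fun v => q x * (`|v x| `^ (p x - 2) * v x))
  _ _ c1 c2'.
have c123 := @cvgD R R {ptws T -> R} (nbhs u) (nbhs_filter u)
  (fun v => plaplacian G p v x - q x * (`|v x| `^ (p x - 2) * v x))
  (fun v => lambda * f x (v x)) _ _ c12 c3'.
have -> : residual x = fun v => plaplacian G p v x -
    q x * (`|v x| `^ (p x - 2) * v x) + lambda * f x (v x).
  by apply/funext => v; rewrite /residual mulrA.
exact: c123.
Qed.

Lemma residual_side u x : (forall y, 0 <= u y) -> u x = 0 -> 0 < lambda * f x 0 ->
  0 < residual x u.
Proof.
move=> u0 ux f0; rewrite /residual ux mulr0 subr0 ltr_wpDl // sumr_ge0 // => y _.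
by rewrite ux subr0 !mulr_ge0 ?powR_ge0 ?weight_ge0.
Qed.

(** At a maximum point all differences [u y - u x] are nonpositive, hence so is the Laplacian. *)
Lemma residual_inner u x c : 0 < c -> u x = c -> (forall y, u y <= c) ->
  lambda * f x c < q x * c `^ (p x - 1) -> residual x u < 0.
Proof.
move=> c0 ux uc lt; rewrite /residual ux -mulrA mulr_norm_powR //.
suff : plaplacian G p u x <= 0 by move: lt; lra.
apply: sumr_le0 => y _; rewrite ux mulr_le0_ge0 ?weight_ge0 //.
by rewrite mulr_ge0_le0 ?powR_ge0 // subr_le0.
Qed.

(** All differences [u y - u x] lie in [[-c, 0]], so each term of the Laplacian is at least
    [- weight G x y * c ^ (p x - 1)]. *)
Lemma residual_outer u x c : 0 < c -> (forall y, 0 <= u y) -> u x = c ->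
  (forall y, u y <= c) ->
  (\sum_y weight G x y + q x) * c `^ (p x - 1) < lambda * f x c ->
  0 < residual x u.
Proof.
move=> c0 u0 ux uc lt; rewrite /residual ux -mulrA mulr_norm_powR //.
suff : - (\sum_y weight G x y * c `^ (p x - 1)) <= plaplacian G p u x.
  by rewrite -mulr_suml; move: lt; rewrite mulrDl; lra.
rewrite -sumrN; apply: ler_sum => y _; rewrite ux mulrC -mulNr.
rewrite ler_wpM2r ?weight_ge0 // -mulr_norm_powR // lerNl -mulrN opprB.
have dy : 0 <= c - u y by rewrite subr_ge0.
have dc : c - u y <= c by rewrite gerBl.
rewrite distrC ler_pM ?powR_ge0 // ge0_ler_powR ?nnegrE ?normr_ge0 //.
by rewrite !ger0_norm ?(ltW c0).
Qed.

End Field.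

End Topology.

(** * Boundary signs from the growth of [f], and the two positive solutions *)

Theorem theorem14 (R : realType) (T : finType) (G : wgraph R T)
    (S dS : {set T})
    (S_neq0 : (0 < #|S|)%N) (dS_neq0 : (0 < #|dS|)%N)
    (SdS_disj : [disjoint S & dS]) (SdS_cover : S :|: dS = [set: T])
    (q p : T -> R) (f : T -> R -> R)
    (q_gt0 : forall x, x \in S -> 0 < q x)
    (p_ge2 : forall x, 2 <= p x)
    (f_cont : forall x, x \in S -> continuous (f x))
    (m1 m2 phi1 phi2 psi1 psi2 : T -> R)
    (m1_ge2 : forall x, x \in S -> 2 <= m1 x)
    (m2_ge2 : forall x, x \in S -> 2 <= m2 x)
    (phi1_gt0 : forall x, x \in S -> 0 < phi1 x)
    (phi2_gt0 : forall x, x \in S -> 0 < phi2 x)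
    (psi1_gt0 : forall x, x \in S -> 0 < psi1 x)
    (psi2_gt0 : forall x, x \in S -> 0 < psi2 x)
    (f_bounds : forall (x : T) (t : R), x \in S -> 0 <= t ->
       psi1 x + phi1 x * t `^ (m1 x - 1) <= f x t
         <= phi2 x * t `^ (m2 x - 1) + psi2 x)
    (m1_gt_p : setmax [set: T] p < setmin S m1)
    (gamma : R) (gamma_gt : gamma0 R dS < gamma)
    (lambda : R) (lambda_gt0 : 0 < lambda)
    (lambda_lt : lambda < lambda3 S dS p q m2 phi2 psi2 gamma) :
  exists u v : T -> R,
    [/\ positive_solution G S dS p q f lambda u,
        positive_solution G S dS p q f lambda v,
        u <> v & 1 < l2norm v].
Proof.
have [x0 x0S] : exists x, x \in S by apply/card_gt0P.
have [y0 y0dS] : exists y, y \in dS by apply/card_gt0P.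
have offS x : (x \notin S) = (x \in dS).
  have := finset.in_setT x; rewrite -SdS_cover inE => /orP[xS|xdS].
    by rewrite xS (disjointFr SdS_disj xS).
  by rewrite xdS (disjointFl SdS_disj xdS).
have y0S : y0 \notin S by rewrite offS.
have cTn : (#|dS| <= #|T|)%N by apply: max_card.
have gamma1 : 1 < gamma.
  apply: le_lt_trans gamma_gt; rewrite /gamma0.
  have h (n : nat) : (0 < n)%N -> 1 <= n%:R `^ (1 / 2) :> R.
    by move=> n0; rewrite -[leLHS](powRr0 n%:R) ler_powR ?ler1n // divr_ge0.
  rewrite -[leLHS]mulr1 ler_pM ?mulr_ege1 ?h // ler1n.
  exact: leq_trans cTn.
have gamma_gt0 : 0 < gamma by exact: lt_trans gamma1.
have [[xp xpS ep] hp] := setminP p S_neq0.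
have [[xq xqS eq] hq] := setminP q S_neq0.
have [[xm xmS em] hm] := setmaxP m2 S_neq0.
have [[xf xfS ef] hf] := setmaxP phi2 S_neq0.
have [[xs xsS es] hs] := setmaxP psi2 S_neq0.
have [[xm1 xm1S em1] hm1] := setminP m1 S_neq0.
have T0 : (0 < #|[set: T]|)%N by apply/card_gt0P; exists x0; rewrite inE.
have [_ hpT] := setmaxP p T0.
(* After multiplication by [gamma] this follows from [lambda3_bound]; as [1 < gamma], the exponents
   [m2 x] and [p x] can be compared with their extreme values. *)
have inner_lt x : x \in S -> lambda * f x gamma < q x * gamma `^ (p x - 1).
  move=> xS.
  have key : lambda * (setmax S phi2 * gamma `^ setmax S m2 + setmax S psi2 * gamma)
      < setmin S q * gamma `^ setmin S p.
    apply: (lambda3_bound _ S_neq0 _ _ _ _ gamma_gt0 lambda_gt0 lambda_lt).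
    - by rewrite dS_neq0.
    - by rewrite ep.
    - by rewrite eq q_gt0.
    - by rewrite ef phi2_gt0.
    - by rewrite es psi2_gt0.
  have /andP[_ fle] := f_bounds x gamma xS (ltW gamma_gt0).
  rewrite -(ltr_pM2l gamma_gt0) mulrCA [ltRHS]mulrCA.
  rewrite mulr_powRB1 ?(ltW gamma_gt0) //; last by have := p_ge2 x; lra.
  apply: le_lt_trans (lt_le_trans key _); last first.
    apply: ler_pM; rewrite ?powR_ge0 ?hq //; first by rewrite eq ltW ?q_gt0.
    by rewrite ler_powR ?hp // ltW.
  rewrite ler_pM2l //.
  apply: (le_trans (ler_wpM2l (ltW gamma_gt0) fle)).
  rewrite mulrDr mulrCA mulr_powRB1 ?(ltW gamma_gt0) //; last first.
    by have := m2_ge2 x xS; lra.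
  apply: lerD; last by rewrite mulrC ler_wpM2r ?(ltW gamma_gt0) ?hs.
  apply: ler_pM; rewrite ?powR_ge0 ?hf ?(ltW (phi2_gt0 x xS)) //.
  by rewrite ler_powR ?hm // ltW.
(* Because of the gap [eps] between the exponents, [lambda * phi1 x * M ^ (m1 x - 1)] dominates
   [W x * M ^ (p x - 1)] once [1 <= M] and [M ^ eps] bounds every [W x / (lambda * phi1 x)]. The sum
   [C] of these quotients bounds them all. *)
pose eps := setmin S m1 - setmax [set: T] p.
have eps0 : 0 < eps by rewrite subr_gt0.
pose W x := \sum_y weight G x y + q x.
have W0 x : x \in S -> 0 <= W x.
  by move=> xS; rewrite addr_ge0 ?(ltW (q_gt0 x xS)) // sumr_ge0 // => y _; exact: weight_ge0.
pose C := \sum_(x in S) W x / (lambda * phi1 x).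
have C_term x : x \in S -> 0 <= W x / (lambda * phi1 x).
  by move=> xS; rewrite divr_ge0 ?W0 // mulr_ge0 ?(ltW (phi1_gt0 x xS)) ?ltW.
have C0 : 0 <= C by apply: sumr_ge0.
(* The last term ensures [C <= M ^ eps], the others [gamma < M]. *)
pose M := gamma + (1 + C `^ eps^-1).
have gM : gamma < M by rewrite ltrDl ltr_pwDl ?powR_ge0.
have M0 : 0 < M by exact: lt_trans gM.
have M1 : 1 <= M by exact: ltW (lt_trans gamma1 gM).
have CM : C <= M `^ eps.
  have -> : C = (C `^ eps^-1) `^ eps by rewrite -powRrM mulVf ?gt_eqF // powRr1.
  by rewrite ge0_ler_powR ?nnegrE ?powR_ge0 ?(ltW M0) ?(ltW eps0) // /M addrA lerDr addr_ge0 // ltW.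
have outer_lt x : x \in S -> W x * M `^ (p x - 1) < lambda * f x M.
  move=> xS; have /andP[fge _] := f_bounds x M xS (ltW M0).
  have lf0 : 0 < lambda * phi1 x by rewrite mulr_gt0 ?phi1_gt0.
  apply: (@le_lt_trans _ _ (lambda * (phi1 x * M `^ (m1 x - 1)))); last first.
    rewrite ltr_pM2l //; apply: lt_le_trans fge; by rewrite ltrDr psi1_gt0.
  rewrite mulrA [leRHS]mulrC -ler_pdivrMr // mulrAC.
  have WM : W x / (lambda * phi1 x) <= M `^ eps.
    apply: le_trans CM; rewrite /C (bigD1 x) //= lerDl sumr_ge0 // => y /andP[yS _].
    exact: C_term.
  apply: (le_trans (ler_wpM2r (powR_ge0 _ _) WM)).
  rewrite -powRD; last by rewrite (gt_eqF M0) implybT.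
  rewrite ler_powR // /eps.
  by have := hm1 x xS; have := hpT x (finset.in_setT x); lra.
pose g := residual G p q f lambda.
have g_cont x : x \in S -> continuous (g x).
  by move=> xS; apply: residual_continuous => //; exact: f_cont.
have g_side (u : T -> R) x : (forall y, 0 <= u y) /\ (forall y, y \notin S -> u y = 0) ->
    x \in S -> u x = 0 -> 0 < g x u.
  move=> [u0 _] xS ux; apply: residual_side => //; rewrite mulr_gt0 //.
  have /andP[h _] := f_bounds x 0 xS (lexx 0); apply: lt_le_trans h.
  by rewrite ltr_pwDl ?psi1_gt0 // mulr_ge0 ?powR_ge0 // ltW ?phi1_gt0.
have g_inner (u : T -> R) x : (forall y, 0 <= u y) /\ (forall y, y \notin S -> u y = 0) ->
    x \in S -> u x = gamma -> (forall y, u y <= gamma) -> g x u < 0.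
  by move=> _ xS ux ule; apply: residual_inner gamma_gt0 ux ule _; rewrite ?inner_lt.
have g_outer (u : T -> R) x : (forall y, 0 <= u y) /\ (forall y, y \notin S -> u y = 0) ->
    x \in S -> u x = M -> (forall y, u y <= M) -> 0 < g x u.
  by move=> [u0 _] xS ux ule; apply: residual_outer M0 u0 ux ule _; rewrite ?outer_lt.
(* Strict positivity is automatic: by [g_side] the field is positive, not zero, wherever a
   nonnegative [u] vanishes in [S]. *)
have solution (u : T -> R) : (forall y, 0 <= u y) /\ (forall y, y \notin S -> u y = 0) ->
    (forall x, x \in S -> g x u = 0) -> positive_solution G S dS p q f lambda u.
  move=> au gu; have [u0 uS] := au; split=> x xS.
  - by have := gu x xS; rewrite /g /residual; lra.
  - by rewrite uS // offS.
  - rewrite lt_neqAle u0 andbT eq_sym; apply/eqP => ux.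
    by have := g_side u x au xS ux; rewrite gu // ltxx.
have [u [au ule gu]] := zero_in_box x0S y0S gamma_gt0 g_cont g_side g_inner.
have [v [av [x xS vx] gv]] :=
  zero_in_shell x0S y0S gamma_gt0 g_cont g_side g_inner gM g_outer.
exists u, v; split; [exact: solution | exact: solution | |].
  (* If the two agreed, [u x <= gamma <= v x] would make [x] a maximum point of value [gamma], where
     the field is negative. *)
  move=> uv; have ux : u x = gamma by apply/eqP; rewrite eq_le ule uv.
  by have := g_inner u x au xS ux ule; rewrite gu // ltxx.
(* The single coordinate [v x >= gamma > 1] already pushes the norm beyond 1. *)
rewrite /l2norm -[ltLHS]sqrtr1 ltr_sqrt.
  rewrite (bigD1 x) //= ltr_wpDr ?sumr_ge0 // => [y _|]; first exact: sqr_ge0.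
  have v1 : 1 < v x by exact: lt_le_trans vx.
  by rewrite ger0_norm ?expr_gt1 // ltW // (lt_trans ltr01).
apply: (@lt_le_trans _ _ (`|v x| ^+ 2)).
  by rewrite exprn_gt0 // normr_gt0 gt_eqF // (lt_le_trans gamma_gt0).
by rewrite (bigD1 x) //= lerDl sumr_ge0 // => y _; exact: sqr_ge0.
Qed.
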